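(* Let $\varepsilon>0$ and let $\mathcal{A}\in\mathbb{R}^{n_1\times\dots\times n_d}$ belong to $\mathcal{T}_\varepsilon(r_1,\dots,r_d)$, i.e. there exists $\mathcal{E}\in\mathbb{R}^{n_1\times\dots\times n_d}$ with $\|\mathcal{E}\|_F\le\varepsilon$ such that $\mathcal{A}+\mathcal{E}$ has multilinear rank componentwise at most $(r_1,\dots,r_d)$. For $k=1,\dots,d$ let $X_k\in\mathbb{R}^{\left(\prod_{j\ne k}n_j\right)\times r_k}$ and $Y_k\in\mathbb{R}^{n_k\times(r_k+\ell_k)}$ be sketch matrices, and let $$\widehat{\mathcal{A}}=(\mathcal{A}\times_{k=1}^dY_k^T)\times_{k=1}^d\mathcal{A}_kX_k(Y_k^T\mathcal{A}_kX_k)^\dagger .$$ Set $$\tau_k:=\sqrt{1+\|(Y_k^TQ_k)^\dagger\|_2^2\,\|Y_k^TQ_{k\perp}\|_2^2},\qquad\rho_k:=\sqrt{1+\|\widetilde V_{k\perp}^TX_k\|_2^2\,\|(\widetilde V_k^TX_k)^\dagger\|_2^2},$$ where $\widetilde V_k$ is an orthogonal matrix (that is, a matrix with orthonormal columns) with the first $r_k$ right singular vectors of $\mathcal{A}_k$ and $Q_k=\mathrm{orth}(\mathcal{A}_kX_k)$. Then, denoting $\tau=\max_k\tau_k$ and $\rho=\max_k\rho_k$, the following bound holds: $$\|\mathcal{A}-\widehat{\mathcal{A}}\|_F\le\varepsilon\,\rho\,\big((1+\tau)^d-1\big).$$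
   Context: For a tensor $\mathcal{A}\in\mathbb{R}^{n_1\times\dots\times n_d}$, $\mathcal{A}_k\in\mathbb{R}^{n_k\times\prod_{j\ne k}n_j}$ denotes its mode-$k$ matricization: $(\mathcal{A}_k)_{i_k,j}=\mathcal{A}_{i_1,\dots,i_d}$ with $j=1+\sum_{t\neq k}(i_t-1)J_t$, $J_t=\prod_{s<t,\,s\ne k}n_s$. The multilinear rank of $\mathcal{A}$ is the tuple $(\mathrm{rank}\,\mathcal{A}_1,\dots,\mathrm{rank}\,\mathcal{A}_d)$. The mode-$k$ product of $\mathcal{A}$ with $M\in\mathbb{R}^{J\times n_k}$ is the tensor $\mathcal{A}\times_kM$ with entries $(\mathcal{A}\times_kM)_{i_1\dots i_{k-1}\,j\,i_{k+1}\dots i_d}=\sum_{s=1}^{n_k}\mathcal{A}_{i_1\dots i_{k-1}\,s\,i_{k+1}\dots i_d}M_{js}$, and $\mathcal{A}\times_{k=1}^dM_k=\mathcal{A}\times_1M_1\times_2\dots\times_dM_d$. $\|\cdot\|_F$ is the Frobenius norm, $\|\cdot\|_2$ the spectral norm and $\dagger$ the Moore-Penrose pseudoinverse. $\mathrm{orth}(M)$ denotes the $Q$ factor (with orthonormal columns) of an economy-size QR factorization of a matrix $M$ with at least as many rows as columns, so $Q_k\in\mathbb{R}^{n_k\times r_k}$; here $r_k\le n_k$ and $r_k\le\prod_{j\ne k}n_j$. $Q_{k\perp}$ and $\widetilde V_{k\perp}$ are matrices whose columns form orthonormal bases of the orthogonal complements of the column spaces of $Q_k$ and $\widetilde V_k$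 (in $\mathbb{R}^{n_k}$ and $\mathbb{R}^{\prod_{j\neq k}n_j}$ respectively). Singular vectors are ordered by non-increasing singular values. The $\ell_k\ge0$ are integers (oversampling parameters); norms of empty matrices are $0$.
   Formalization: The formal theorem adds that Y_k^T Q_k has full column rank r_k and that Ṽ_k^T X_k is invertible for every k; without these the bound fails (e.g. d=1, n=r=1, A=1, and X=0, Y=1 or X=1, Y=0, with ε<1). *)

(* Defs.v *)
From HB Require Import structures.
From mathcomp Require Import all_boot all_order all_algebra.
From mathcomp Require Import boolp classical_sets reals.

Set Implicit Arguments.
Unset Strict Implicit.
Unset Printing Implicit Defensive.

Import Order.TTheory GRing.Theory Num.Theory.

Local Open Scope ring_scope.

Section MatrixNotions.

Context {R : realType}.

Definition vnorm2 m (x : 'cV[R]_m) : R := Num.sqrt (\sum_i x i 0 ^+ 2).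

(* The supremum over the closed unit ball is 0 when M has no row or no column. *)
Definition spnorm m p (M : 'M[R]_(m, p)) : R :=
  sup [set vnorm2 (M *m x) | x in [set x : 'cV[R]_p | vnorm2 x <= 1]]%classic.

Definition penrose m p (M : 'M[R]_(m, p)) (B : 'M[R]_(p, m)) : Prop :=
  [/\ M *m B *m M = M, B *m M *m B = B,
      (M *m B)^T = M *m B & (B *m M)^T = B *m M].

Definition pinv m p (M : 'M[R]_(m, p)) : 'M[R]_(p, m) :=
  xget 0 [set B | penrose M B]%classic.

Definition orthonormal_cols m p (M : 'M[R]_(m, p)) : Prop := M^T *m M = 1%:M.

(* Q is the Q factor of some economy-size QR factorization M = Q *m T. This is
   a relation because T, and for rank-deficient M also the column space of Q,
   is not determined by M. *)
Definition is_orth m p (M Q : 'M[R]_(m, p)) : Prop :=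
  orthonormal_cols Q /\
  exists T : 'M[R]_p, (forall i j : 'I_p, (j < i)%N -> T i j = 0) /\ M = Q *m T.

Definition is_orth_compl m p q (Q : 'M[R]_(m, p)) (Qp : 'M[R]_(m, q)) : Prop :=
  orthonormal_cols Qp /\
  forall x : 'cV[R]_m, Q^T *m x = 0 <-> exists c : 'cV[R]_q, x = Qp *m c.

Definition is_svd m p (M : 'M[R]_(m, p)) (U : 'M[R]_(m, minn m p))
    (s : 'rV[R]_(minn m p)) (W : 'M[R]_(p, minn m p)) : Prop :=
  [/\ orthonormal_cols U, orthonormal_cols W,
      forall i, 0 <= s 0 i,
      forall i j : 'I_(minn m p), (i <= j)%N -> s 0 j <= s 0 i &
      M = U *m diag_mx s *m W^T].

Definition leading_rsv m p q (M : 'M[R]_(m, p)) (V : 'M[R]_(p, q)) : Prop :=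
  exists U s W (le_q : (q <= minn m p)%N),
    is_svd M U s W /\ V = colsub (widen_ord le_q) W.

Lemma gram_unit m p (C : 'M[R]_(m, p)) : row_free C^T -> C^T *m C \in unitmx.
Proof.
move=> fC; rewrite -row_free_unit -kermx_eq0; apply/eqP/row_matrixP => i.
set v := row i _; have vG : v *m (C^T *m C) = 0.
  by rewrite -row_mul mulmx_ker row0.
rewrite row0; apply: (row_free_inj fC); rewrite mul0mx.
have {}vG : (v *m C^T) *m (v *m C^T)^T = 0.
  by rewrite trmx_mul trmxK !mulmxA -(mulmxA v) vG mul0mx.
move: (v *m C^T) vG => w w0; apply/rowP => j; rewrite mxE.
have /eqP := congr1 (fun N : 'M_1 => N 0 0) w0; rewrite !mxE.
rewrite psumr_eq0 => [/allP/(_ j (mem_index_enum _))|i0 _].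
  by rewrite mxE mulf_eq0 orbb => /eqP.
by rewrite mxE -expr2 sqr_ge0.
Qed.

Lemma penrose_factor m q p (C : 'M[R]_(m, q)) (F : 'M[R]_(q, p)) :
  row_free C^T -> row_free F ->
  penrose (C *m F)
    (F^T *m invmx (F *m F^T) *m invmx (C^T *m C) *m C^T).
Proof.
move=> fC fF; have uC := gram_unit fC.
have uF : F *m F^T \in unitmx.
  by have := @gram_unit _ _ F^T; rewrite trmxK; apply.
move GCE: (C^T *m C) uC => GC uC; move GFE: (F *m F^T) uF => GF uF.
have tGC : (invmx GC)^T = invmx GC by rewrite trmx_inv -GCE trmx_mul trmxK.
have tGF : (invmx GF)^T = invmx GF by rewrite trmx_inv -GFE trmx_mul trmxK.
set M := C *m F; set B := _ *m C^T.
have MB : M *m B = C *m invmx GC *m C^T.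
  by rewrite /M /B !mulmxA -(mulmxA C F) GFE -(mulmxA C GF) mulmxV // mulmx1.
have BM : B *m M = F^T *m invmx GF *m F.
  rewrite /M /B !mulmxA -(mulmxA _ C^T C) GCE.
  by rewrite -(mulmxA _ (invmx GC) GC) mulVmx // mulmx1.
split.
- rewrite MB /M !mulmxA -(mulmxA _ C^T C) GCE.
  by rewrite -(mulmxA _ (invmx GC) GC) mulVmx // mulmx1.
- rewrite BM /B !mulmxA -(mulmxA _ F F^T) GFE.
  by rewrite -(mulmxA _ (invmx GF) GF) mulVmx // mulmx1.
- by rewrite MB !trmx_mul trmxK tGC mulmxA.
- by rewrite BM !trmx_mul trmxK tGF mulmxA.
Qed.

Lemma penrose_ex m p (M : 'M[R]_(m, p)) : exists B, penrose M B.
Proof.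
rewrite -{1}[M]mulmx_base; eexists; apply: penrose_factor (row_base_free M).
by rewrite /row_free mxrank_tr; exact: col_base_full.
Qed.

Lemma pinvP m p (M : 'M[R]_(m, p)) : penrose M (pinv M).
Proof.
by have [B MB] := penrose_ex M; apply: (@xgetPex _ 0 _ (ex_intro _ B MB)).
Qed.

Lemma penrose_uniq m p (M : 'M[R]_(m, p)) B : penrose M B -> B = pinv M.
Proof.
move=> [b1 b2 b3 b4]; have [c1 c2 c3 c4] := pinvP M; set C := pinv M in c1 c2 c3 c4 *.
have eMB : M *m B = M *m C.
  have e : M *m B = (M *m C) *m (M *m B) by rewrite mulmxA c1.
  by rewrite -[LHS]b3 e trmx_mul b3 c3 mulmxA b1.
have eBM : B *m M = C *m M.
  have e : B *m M = (B *m M) *m (C *m M) by rewrite -mulmxA (mulmxA M) c1.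
  by rewrite -[LHS]b4 e trmx_mul b4 c4 -mulmxA (mulmxA M) b1.
by rewrite -b2 -mulmxA eMB mulmxA eBM c2.
Qed.

End MatrixNotions.

Section Tensors.

Variable d : nat.

Definition tidx (n : 'I_d -> nat) : finType := {dffun forall k : 'I_d, 'I_(n k)}.

Definition tensor (R : realType) (n : 'I_d -> nat) := {ffun tidx n -> R}.

Definition cosize (n : 'I_d -> nat) (k : 'I_d) : nat :=
  (\prod_(j < d | j != k) n j)%N.

Definition stride (n : 'I_d -> nat) (k t : 'I_d) : nat :=
  (\prod_(s < d | (s < t) && (s != k)) n s)%N.

Definition mode_col (n : 'I_d -> nat) (k : 'I_d) (x : tidx n) : nat :=
  (\sum_(t < d | t != k) x t * stride n k t)%N.

Lemma mode_col_partial n k b :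
  (forall x : tidx n, \sum_(t < d | (t < b)%N && (t != k)) x t * stride n k t
      < \prod_(s < d | (s < b)%N && (s != k)) n s)%N /\
  (forall x y : tidx n,
      (\sum_(t < d | (t < b)%N && (t != k)) x t * stride n k t =
       \sum_(t < d | (t < b)%N && (t != k)) y t * stride n k t)%N ->
      forall t : 'I_d, (t < b)%N -> t != k -> x t = y t).
Proof.
elim: b => [|b [IHlt IHeq]].
  by split=> [x|//]; rewrite !big_pred0.
have [lt_bd|le_db] := ltnP b d; last first.
  have eP : (fun t : 'I_d => (t < b.+1)%N && (t != k)) =1
            (fun t : 'I_d => (t < b)%N && (t != k)).
    move=> t; have ltb : (t < b)%N by apply: leq_trans (ltn_ord t) le_db.
    by rewrite ltb ltnS (ltnW ltb).
  split=> [x|x y]; first by rewrite !(eq_bigl _ _ eP).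
  rewrite !(eq_bigl _ _ eP).
  by move=> /IHeq H t _; apply: H; apply: leq_trans (ltn_ord t) le_db.
pose o := Ordinal lt_bd.
have [ok|nok] := eqVneq o k.
  have eP : (fun t : 'I_d => (t < b.+1)%N && (t != k)) =1
            (fun t : 'I_d => (t < b)%N && (t != k)).
    move=> t; case: (eqVneq t k) => [->|ntk]; rewrite ?andbF // !andbT ltnS leq_eqVlt.
    by rewrite -ok in ntk; rewrite -val_eqE /= in ntk; rewrite (negPf ntk).
  split=> [x|x y]; first by rewrite !(eq_bigl _ _ eP).
  rewrite !(eq_bigl _ _ eP) => /IHeq H t ltb ntk; apply: (H) => //.
  by have := eP t; rewrite ltb ntk /= andbT => <-.
have eP : (fun t : 'I_d => [&& (t < b.+1)%N, t != k & t != o]) =1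
          (fun t : 'I_d => (t < b)%N && (t != k)).
  move=> t; rewrite ltnS leq_eqVlt -(val_eqE t o) /=.
  by case: (eqVneq (t : nat) b) => [->|]; rewrite ?ltnn ?andbF ?andbT.
have eP' : (fun t : 'I_d => ((t < b.+1)%N && (t != k)) && (t != o)) =1
           (fun t : 'I_d => (t < b)%N && (t != k)).
  by move=> t; rewrite -andbA eP.
have Po : ((o < b.+1)%N && (o != k)) by rewrite ltnS leqnn nok.
have sumE (x : tidx n) :
    (\sum_(t < d | (t < b.+1)%N && (t != k)) x t * stride n k t =
     x o * stride n k o + \sum_(t < d | (t < b)%N && (t != k)) x t * stride n k t)%N.
  by rewrite (bigD1 o) //= (eq_bigl _ _ eP').
have prodE : (\prod_(s < d | (s < b.+1)%N && (s != k)) n s = n o * stride n k o)%N.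
  by rewrite (bigD1 o) //= (eq_bigl _ _ eP').
split=> [x|x y].
  rewrite sumE prodE; apply: (@leq_trans ((x o).+1 * stride n k o)%N).
    by rewrite mulSn addnC ltn_add2r IHlt.
  by rewrite leq_mul2r ltn_ord orbT.
rewrite !sumE => e.
have := congr1 (fun z => (z %/ stride n k o)%N) e.
have := congr1 (fun z => (z %% stride n k o)%N) e.
have st0 : (0 < stride n k o)%N by apply: leq_ltn_trans (IHlt x).
rewrite !modnMDl !divnMDl // !modn_small ?IHlt // !divn_small ?IHlt // !addn0.
move=> er eq t; rewrite ltnS leq_eqVlt => /orP[/eqP etb _|ltb ntk].
  have -> : t = o by apply: val_inj.
  exact: val_inj.
exact: IHeq _ _ er t ltb ntk.
Qed.

Lemma mode_col_lt n k (x : tidx n) : (mode_col k x < cosize n k)%N.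
Proof.
have [H _] := mode_col_partial n k d; move: (H x).
have eP : (fun t : 'I_d => (t < d)%N && (t != k)) =1 (fun t => t != k).
  by move=> t; rewrite ltn_ord.
by rewrite !(eq_bigl _ _ eP).
Qed.

Lemma mode_col_inj n k (x y : tidx n) :
  x k = y k -> mode_col k x = mode_col k y -> x = y.
Proof.
have [_ H] := mode_col_partial n k d; move: (H x y).
have eP : (fun t : 'I_d => (t < d)%N && (t != k)) =1 (fun t => t != k).
  by move=> t; rewrite ltn_ord.
rewrite !(eq_bigl _ _ eP) => {}H ek /H {}H; apply/ffunP => t.
by have [->|ntk] := eqVneq t k; last apply: H.
Qed.

Variable R : realType.

(* At most one index x contributes to each entry, see mode_col_inj and
   matricizeE. *)
Definition matricize n (A : tensor R n) (k : 'I_d) : 'M[R]_(n k, cosize n k) :=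
  \matrix_(i, j) \sum_(x : tidx n | (x k == i) && (mode_col k x == j)) A x.

Lemma matricizeE n (A : tensor R n) k (x : tidx n) :
  matricize A k (x k) (Ordinal (mode_col_lt k x)) = A x.
Proof.
rewrite mxE (big_pred1 x) // => y; apply/andP/eqP => [[/eqP e1 /eqP e2]|->] //=.
exact: mode_col_inj e1 e2.
Qed.

Definition mlrank n (A : tensor R n) (k : 'I_d) : nat := \rank (matricize A k).

Definition fnorm n (A : tensor R n) : R := Num.sqrt (\sum_(x : tidx n) A x ^+ 2).

Definition in_Teps (eps : R) n (r : 'I_d -> nat) (A : tensor R n) : Prop :=
  exists E : tensor R n,
    fnorm E <= eps /\ forall k, (mlrank (A + E)%R k <= r k)%N.

(* The mode-k product; meant for shapes n and n' that agree off k. The indices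
   x that agree with y off k are those obtained from y by letting the k-th
   component range over 'I_(n k). *)
Definition mode_prod n n' (k : 'I_d) (M : 'M[R]_(n' k, n k)) (A : tensor R n) :
    tensor R n' :=
  [ffun y : tidx n' =>
     \sum_(x : tidx n | [forall t, (t != k) ==> (x t == y t :> nat)])
        A x * M (y k) (x k)].

Definition cast_tensor n n' (e : forall t, n t = n' t) (A : tensor R n) :
    tensor R n' :=
  [ffun y : tidx n' =>
     A (finfun (fun t => cast_ord (esym (e t)) (y t)))].

(* The shape of a tensor of shape n after its first j modes have been
   multiplied by matrices with m t rows. *)
Definition step_dims (n m : 'I_d -> nat) (j : nat) (t : 'I_d) : nat :=
  if (t < j)%N then m t else n t.

Lemma step_dims_new n m (k : 'I_d) : m k = step_dims n m k.+1 k.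
Proof. by rewrite /step_dims ltnSn. Qed.

Lemma step_dims_old n m (k : 'I_d) : n k = step_dims n m k k.
Proof. by rewrite /step_dims ltnn. Qed.

Lemma step_dims_end n m t : step_dims n m d t = m t.
Proof. by rewrite /step_dims ltn_ord. Qed.

Fixpoint multi_prod_rec n m (M : forall k : 'I_d, 'M[R]_(m k, n k))
    (A : tensor R n) (j : nat) : (j <= d)%N -> tensor R (step_dims n m j) :=
  match j with
  | 0 => fun _ => A
  | j'.+1 => fun lt_j'd =>
      let k := Ordinal lt_j'd in
      @mode_prod _ (step_dims n m j'.+1) k
        (castmx (step_dims_new n m k, step_dims_old n m k) (M k))
        (multi_prod_rec M A (ltnW lt_j'd))
  end.

(* A x_1 M_1 x_2 M_2 ... x_d M_d *)
Definition multi_prod n m (M : forall k : 'I_d, 'M[R]_(m k, n k))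
    (A : tensor R n) : tensor R m :=
  cast_tensor (step_dims_end n m) (multi_prod_rec M A (leqnn d)).

Definition mxnat p q (M : 'M[R]_(p, q)) (a b : nat) : R :=
  if insub a is Some i then if insub b is Some j then M i j else 0 else 0.

Lemma mxnatE p q (M : 'M[R]_(p, q)) (i : 'I_p) (j : 'I_q) : mxnat M i j = M i j.
Proof. by rewrite /mxnat !valK. Qed.

Lemma mxnat_cast p q p' q' (e : (p = p') * (q = q')) (M : 'M[R]_(p, q)) :
  mxnat (castmx e M) = mxnat M.
Proof. by case: e => e1 e2; case: _ / e1; case: _ / e2; rewrite castmx_id. Qed.

Lemma multi_prod_recE n m (M : forall k : 'I_d, 'M[R]_(m k, n k)) A j
    (le_jd : (j <= d)%N) y :
  multi_prod_rec M A le_jd y =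
    \sum_(x : tidx n | [forall t : 'I_d, (j <= t)%N ==> (x t == y t :> nat)])
      A x * \prod_(t < d | (t < j)%N) mxnat (M t) (y t) (x t).
Proof.
elim: j le_jd y => [|j IHj] lt_jd y /=.
  rewrite (big_pred1 y) => [|x].
    by rewrite big_pred0 ?mulr1.
  apply/forallP/eqP => [H|-> t]; last by rewrite eqxx.
  by apply/ffunP => t; apply/val_inj/eqP/H.
set k := Ordinal lt_jd; rewrite ffunE.
under [LHS]eq_bigr => x' Hx'.
  rewrite IHj big_distrl /=; over.
rewrite /= (exchange_big_dep (fun x : tidx n =>
  [forall t : 'I_d, (j < t)%N ==> (x t == y t :> nat)])) /=; first last.
  move=> x' x /forallP Hx' /forallP Hx; apply/forallP => t; apply/implyP => lt_jt.
  have /implyP/(_ (ltnW lt_jt))/eqP -> := Hx t.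
  have /implyP -> // := Hx' t.
  by rewrite -val_eqE /= neq_ltn lt_jt orbT.
apply: eq_bigr => x /forallP Hx.
have xn (t : 'I_d) : (t == k) -> n t = step_dims n m j t.
  by move=> /eqP ->; rewrite /step_dims ltnn.
have yn (t : 'I_d) : (t != k) -> step_dims n m j.+1 t = step_dims n m j t.
  by rewrite -val_eqE /= /step_dims ltnS leq_eqVlt => /negPf ->.
pose f (t : 'I_d) : 'I_(step_dims n m j t) :=
  match boolP (t == k) with
  | AltTrue h => cast_ord (xn t h) (x t)
  | AltFalse h => cast_ord (yn t h) (y t)
  end.
have fk : f k = x k :> nat by rewrite /f; case: {-}_ / boolP => //= /negP[].
have fN t : t != k -> f t = y t :> nat.
  by rewrite /f; case: {-}_ / boolP => //= h; rewrite h.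
rewrite (big_pred1 (finfun f : tidx (step_dims n m j))) /=; last first.
  move=> x'; apply/andP/eqP => [[/forallP H1 /forallP H2]|->].
    apply/ffunP => t; rewrite ffunE; apply: val_inj => /=.
    have [->|ntk] := eqVneq t k.
      by have /implyP/(_ (leqnn _))/eqP <- := H2 k; rewrite fk.
    by have /implyP/(_ ntk)/eqP -> := H1 t; rewrite fN.
  split; apply/forallP => t; apply/implyP; rewrite ffunE.
    by move=> ntk; rewrite fN.
  rewrite leq_eqVlt => /orP[/eqP etk|lt_jt].
    by have -> : t = k by [exact: val_inj]; rewrite fk.
  have ntk : t != k by rewrite -val_eqE /= neq_ltn lt_jt orbT.
  by rewrite fN //; have /implyP/(_ lt_jt) := Hx t.
rewrite -mulrA; congr (_ * _); rewrite [RHS](bigD1 k) //= mulrC; congr (_ * _).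
  by rewrite -mxnatE mxnat_cast ffunE fk.
apply: eq_big => [t|t lt_tj].
  by rewrite -(val_eqE t k) /= ltnS ltn_neqAle andbC.
by rewrite ffunE fN // -val_eqE /= neq_ltn lt_tj.
Qed.

Lemma multi_prodE n m (M : forall k : 'I_d, 'M[R]_(m k, n k)) A y :
  multi_prod M A y = \sum_(x : tidx n) A x * \prod_t M t (y t) (x t).
Proof.
rewrite ffunE multi_prod_recE; apply: eq_big => [x|x _].
  by apply/forallP => t; rewrite leqNgt ltn_ord.
congr (_ * _); apply: eq_big => [t|t _]; first by rewrite ltn_ord.
by rewrite ffunE -mxnatE.
Qed.

End Tensors.

(* Main.v *)
Require Import Defs.
From HB Require Import structures.
From mathcomp Require Import all_boot all_order all_algebra.
From mathcomp Require Import boolp classical_sets reals.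
From mathcomp Require Import ring lra.

(** The approximation is the simultaneous application to A, in every mode k, of
    the matrix C (Y^T C)^+ Y^T with C = A_k X. The proof compares it with the
    oblique projector P_k = Q (Y^T Q)^+ Y^T, whose image is the column space of
    Q, and telescopes over the modes.

    Write C = Q T. If T is invertible then C (Y^T C)^+ Y^T = P_k. If it is not,
    these two matrices may be very different, and the norm of the first is then
    not controlled by tau_k; but they still agree on A_k, which is all that the
    multilinear product sees ([eq_multi_prod_matricize], [sketch_proj_eq]).
    Indeed, as V^T X is invertible, T can be singular only if one of the leading
    singular values of A_k vanishes, hence all later ones vanish as well
    ([unit_or_exact]); then the columns of A_k are combinations of those of
    C, and both matrices fix C.

    Three estimates are needed in each mode, all in the Frobenius norm.
    - |N - P_k N| <= tau_k |N - Q Q^T N| for every N ([oblique_proj_error]):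
      I - P_k kills the column space of Q, and on Q_perp it is a sum of two maps
      with orthogonal images, the inclusion of Q_perp and - P_k.
    - |A_k - Q Q^T A_k| <= rho_k |A_k - A_k V V^T| ([rangefinder_error]): I - Q Q^T
      kills A_k X, so that A_k may first be multiplied on the right by
      I - X (V^T X)^+ V^T, which is handled as above.
    - |A_k - A_k V V^T| <= |A_k - B| if B has rank at most r_k, by the
      Eckart-Young theorem ([eckart_young]); here B is the matricization of
      A + E, which leaves |E| <= eps.
    So replacing A by A x_k P_k costs at most eps rho tau, while applying P_k to
    any tensor multiplies its norm by at most 1 + tau. Applying the projectors
    one mode after the other ([multi_prod_telescope]) gives the total error
    eps rho tau (1 + (1 + tau) + ... + (1 + tau)^(d-1)), a geometric sum. *)

Set Implicit Arguments.
Unset Strict Implicit.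
Unset Printing Implicit Defensive.

Import Order.TTheory GRing.Theory Num.Theory.
Local Open Scope ring_scope.

(** * Cauchy-Schwarz and Minkowski inequalities for finite sums *)

Section FiniteSums.
Variable R : realType.

(** The sum of the squares (b f_i - c g_i)^2, with b = |g|^2 and c = <f, g>, is
    b (|f|^2 b - c^2). *)
Lemma cauchy_schwarz_sum (I : finType) (f g : I -> R) :
  (\sum_i f i * g i) ^+ 2 <= (\sum_i f i ^+ 2) * (\sum_i g i ^+ 2).
Proof.
set a := \sum_i f i ^+ 2; set b := \sum_i g i ^+ 2; set c := \sum_i f i * g i.
have b_ge0 : 0 <= b by apply: sumr_ge0 => i _; apply: sqr_ge0.
have [b0|b_gt0] := leP b 0.
  have g0 i : g i = 0.
    have /eqP : b = 0 by apply/le_anti; rewrite b0.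
    rewrite psumr_eq0 => [/allP/(_ i (mem_index_enum _))|? _]; last exact: sqr_ge0.
    by rewrite sqrf_eq0 => /eqP.
  rewrite /c big1 => [|i _]; last by rewrite g0 mulr0.
  by rewrite expr0n mulr_ge0 // sumr_ge0 // => i _; apply: sqr_ge0.
have : 0 <= \sum_i (b * f i - c * g i) ^+ 2.
  by apply: sumr_ge0 => i _; apply: sqr_ge0.
have -> : \sum_i (b * f i - c * g i) ^+ 2 = b * (a * b - c ^+ 2).
  transitivity (\sum_i (b ^+ 2 * f i ^+ 2 - 2 * b * c * (f i * g i)
                         + c ^+ 2 * g i ^+ 2)).
    by apply: eq_bigr => i _; ring.
  by rewrite big_split /= sumrB -!mulr_sumr -/a -/b -/c; ring.
by rewrite pmulr_rge0 // subr_ge0.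
Qed.

Lemma minkowski_sum (I : finType) (f g : I -> R) :
  Num.sqrt (\sum_i (f i + g i) ^+ 2) <=
  Num.sqrt (\sum_i f i ^+ 2) + Num.sqrt (\sum_i g i ^+ 2).
Proof.
have CS := cauchy_schwarz_sum f g.
have -> : \sum_i (f i + g i) ^+ 2 =
    \sum_i f i ^+ 2 + \sum_i g i ^+ 2 + 2 * \sum_i f i * g i.
  by rewrite mulr_sumr -!big_split /=; apply: eq_bigr => i _; ring.
have sum_ge0 (h : I -> R) : 0 <= \sum_i h i ^+ 2.
  by apply: sumr_ge0 => i _; apply: sqr_ge0.
move: CS (sum_ge0 f) (sum_ge0 g).
move: (\sum_i f i * g i) (\sum_i f i ^+ 2) (\sum_i g i ^+ 2) => c a b CS a0 b0.
have cab : c <= Num.sqrt a * Num.sqrt b.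
  rewrite -sqrtrM //; apply: le_trans (ler_norm _) _.
  by rewrite -sqrtr_sqr ler_sqrt // mulr_ge0.
rewrite -[leRHS]ger0_norm ?addr_ge0 ?sqrtr_ge0 // -sqrtr_sqr ler_sqrt ?sqr_ge0 //.
by rewrite sqrrD !sqr_sqrtr //; lra.
Qed.

End FiniteSums.

(** * The Frobenius norm *)

Section FrobeniusNorm.
Variable R : realType.

(** The square of the Frobenius norm. The trace form makes its invariance under
    transposition and under orthonormal factors a matter of cyclicity. *)
Definition frob2 m p (M : 'M[R]_(m, p)) : R := \tr (M^T *m M).

Lemma frob2E m p (M : 'M[R]_(m, p)) : frob2 M = \sum_j \sum_i M i j ^+ 2.
Proof.
by apply: eq_bigr => j _; rewrite mxE; apply: eq_bigr => i _; rewrite mxE expr2.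
Qed.

Lemma frob2_ge0 m p (M : 'M[R]_(m, p)) : 0 <= frob2 M.
Proof.
by rewrite frob2E !sumr_ge0 // => j _; rewrite sumr_ge0 // => i _; apply: sqr_ge0.
Qed.

Lemma frob2_eq0 m p (M : 'M[R]_(m, p)) : frob2 M = 0 -> M = 0.
Proof.
move=> /eqP; rewrite frob2E psumr_eq0 => [/allP M0|j _]; last first.
  by apply: sumr_ge0 => i _; apply: sqr_ge0.
apply/matrixP => i j; have := M0 j (mem_index_enum _).
rewrite psumr_eq0 => [/allP/(_ i (mem_index_enum _))|k _]; last exact: sqr_ge0.
by rewrite sqrf_eq0 mxE => /eqP.
Qed.

Lemma frob2_tr m p (M : 'M[R]_(m, p)) : frob2 M^T = frob2 M.
Proof. by rewrite /frob2 trmxK mxtrace_mulC. Qed.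

Lemma frob2N m p (M : 'M[R]_(m, p)) : frob2 (- M) = frob2 M.
Proof.
by rewrite !frob2E; do 2![apply: eq_bigr => ? _]; rewrite mxE sqrrN.
Qed.

Lemma frob2Z m p (c : R) (M : 'M[R]_(m, p)) : frob2 (c *: M) = c ^+ 2 * frob2 M.
Proof.
rewrite !frob2E mulr_sumr; apply: eq_bigr => j _; rewrite mulr_sumr.
by apply: eq_bigr => i _; rewrite mxE exprMn.
Qed.

Lemma frob2_col m p (M : 'M[R]_(m, p)) : frob2 M = \sum_j frob2 (col j M).
Proof.
rewrite frob2E; apply: eq_bigr => j _; rewrite frob2E big_ord1.
by apply: eq_bigr => i _; rewrite mxE.
Qed.

Lemma frob2_orthonormal m p q (Q : 'M[R]_(m, p)) (M : 'M[R]_(p, q)) :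
  orthonormal_cols Q -> frob2 (Q *m M) = frob2 M.
Proof. by move=> QQ; rewrite /frob2 trmx_mul mulmxA -(mulmxA _ Q^T) QQ mulmx1. Qed.

Lemma frob2_pythagoras m p (M N : 'M[R]_(m, p)) :
  M^T *m N = 0 -> frob2 (M + N) = frob2 M + frob2 N.
Proof.
move=> MN; have NM : N^T *m M = 0 by rewrite -[LHS]trmxK trmx_mul trmxK MN trmx0.
by rewrite /frob2 [(M + N)^T]linearD /= mulmxDl !mulmxDr MN NM addr0 add0r mxtraceD.
Qed.

Lemma frob2_proj m p (M : 'M[R]_(m, p)) (H : 'M[R]_m) :
  H^T = H -> H *m H = H -> frob2 M = frob2 (H *m M) + frob2 (M - H *m M).
Proof.
move=> tH HH; rewrite -frob2_pythagoras ?subrKC //.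
by rewrite trmx_mul tH mulmxBr !mulmxA -(mulmxA _ H H) HH subrr.
Qed.

Lemma frob2_projr m p (M : 'M[R]_(m, p)) (H : 'M[R]_p) :
  H^T = H -> H *m H = H -> frob2 M = frob2 (M *m H) + frob2 (M - M *m H).
Proof.
move=> tH HH; rewrite -frob2_tr (frob2_proj _ tH HH).
by rewrite -frob2_tr -[in X in _ + X]frob2_tr linearB /= trmx_mul trmxK tH.
Qed.

End FrobeniusNorm.

(** * The spectral norm *)

Section SpectralNorm.
Variable R : realType.

Lemma vnorm2E m (x : 'cV[R]_m) : vnorm2 x = Num.sqrt (frob2 x).
Proof. by rewrite /vnorm2 frob2E big_ord1. Qed.

Lemma frob2_mul_le m p q (M : 'M[R]_(m, p)) (N : 'M[R]_(p, q)) :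
  frob2 (M *m N) <= frob2 M * frob2 N.
Proof.
rewrite -(frob2_tr M) !frob2E mulr_sumr; apply: ler_sum => j _.
rewrite mulr_suml; apply: ler_sum => i _; rewrite mxE.
apply: le_trans (cauchy_schwarz_sum _ _) _.
by under [in leRHS]eq_bigr do rewrite mxE.
Qed.

(** The Frobenius norm of M is an upper bound. Boundedness is what makes the
    supremum an upper bound of its set. *)
Lemma spnorm_has_ubound m p (M : 'M[R]_(m, p)) :
  has_ubound [set vnorm2 (M *m x) | x in [set x : 'cV[R]_p | vnorm2 x <= 1]]%classic.
Proof.
exists (Num.sqrt (frob2 M)) => _ [x /= x1 <-].
rewrite vnorm2E in x1; rewrite vnorm2E ler_sqrt ?frob2_ge0 //.
apply: le_trans (frob2_mul_le _ _) _; rewrite ler_piMr ?frob2_ge0 //.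
by rewrite -[frob2 x]sqr_sqrtr ?frob2_ge0 // expr_le1 // sqrtr_ge0.
Qed.

Lemma frob2_spnorm_col m p (M : 'M[R]_(m, p)) (x : 'cV[R]_p) :
  frob2 (M *m x) <= spnorm M ^+ 2 * frob2 x.
Proof.
have [x0|x_gt0] := leP (frob2 x) 0.
  have {}x0 : frob2 x = 0 by apply/le_anti; rewrite x0 frob2_ge0.
  by have := frob2_mul_le M x; rewrite x0 !mulr0.
set a := Num.sqrt (frob2 x); have a_gt0 : 0 < a by rewrite sqrtr_gt0.
have aE : a ^+ 2 = frob2 x by rewrite sqr_sqrtr ?ltW.
have : vnorm2 (M *m (a^-1 *: x)) <= spnorm M.
  apply: (ub_le_sup (spnorm_has_ubound M)); exists (a^-1 *: x) => //=.
  by rewrite vnorm2E frob2Z exprVn aE mulVf ?sqrtr1 // gt_eqF.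
rewrite vnorm2E -scalemxAr frob2Z exprVn mulrC => le_s.
rewrite -aE -ler_pdivrMr ?exprn_gt0 // -[leLHS]sqr_sqrtr; last first.
  by rewrite divr_ge0 ?frob2_ge0 ?exprn_ge0 // ltW.
by rewrite ler_pXn2r // nnegrE ?(le_trans _ le_s) ?sqrtr_ge0.
Qed.

Lemma frob2_spnorm m p q (M : 'M[R]_(m, p)) (N : 'M[R]_(p, q)) :
  frob2 (M *m N) <= spnorm M ^+ 2 * frob2 N.
Proof.
rewrite frob2_col [in leRHS]frob2_col mulr_sumr; apply: ler_sum => j _.
by rewrite colE -mulmxA -colE frob2_spnorm_col.
Qed.

(** M^T is bounded by the spectral norm of M since
    |M^T y|^2 = <y, M M^T y> <= |y| * spnorm M * |M^T y|. *)
Lemma frob2_spnorm_tr_col m p (M : 'M[R]_(m, p)) (y : 'cV[R]_m) :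
  frob2 (M^T *m y) <= spnorm M ^+ 2 * frob2 y.
Proof.
set a := frob2 _; have [->|a_neq0] := eqVneq a 0.
  by rewrite mulr_ge0 ?sqr_ge0 ?frob2_ge0.
have a_gt0 : 0 < a by rewrite lt0r a_neq0 frob2_ge0.
rewrite -(ler_pM2r a_gt0) -expr2.
have aE : a = \sum_i y i 0 * (M *m (M^T *m y)) i 0.
  rewrite /a /frob2 trmx_mul trmxK -mulmxA trace_mx11 mxE.
  by apply: eq_bigr => i _; rewrite mxE.
rewrite [in leLHS]aE; apply: le_trans (cauchy_schwarz_sum _ _) _.
have E (z : 'cV[R]_m) : \sum_i z i 0 ^+ 2 = frob2 z by rewrite frob2E big_ord1.
by rewrite !E [leLHS]mulrC [leRHS]mulrAC; apply: ler_wpM2r;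
  rewrite ?frob2_ge0 ?frob2_spnorm.
Qed.

Lemma frob2_spnormr m p q (N : 'M[R]_(m, p)) (M : 'M[R]_(p, q)) :
  frob2 (N *m M) <= frob2 N * spnorm M ^+ 2.
Proof.
rewrite -frob2_tr -(frob2_tr N) trmx_mul mulrC frob2_col [in leRHS]frob2_col mulr_sumr.
by apply: ler_sum => j _; rewrite colE -mulmxA -colE frob2_spnorm_tr_col.
Qed.

End SpectralNorm.

(** * Errors of the oblique projector and of the range finder *)

Section SketchedProjections.
Variable R : realType.

(** For each x, the vector x - Q Q^T x is orthogonal to Q, hence of the form Qp c,
    and applying Qp^T gives c = Qp^T x. *)
Lemma orth_complP m p q (Q : 'M[R]_(m, p)) (Qp : 'M[R]_(m, q)) :
  orthonormal_cols Q -> is_orth_compl Q Qp ->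
  [/\ Q^T *m Qp = 0, Qp^T *m Q = 0 & Qp *m Qp^T = 1%:M - Q *m Q^T].
Proof.
move=> QQ [QpQp spanQp].
have QQp : Q^T *m Qp = 0.
  apply/matrixP => i j; have [_ /(_ _)] := spanQp (Qp *m delta_mx j 0).
  move=> /(_ (ex_intro _ _ erefl)) /matrixP/(_ i 0).
  by rewrite mulmxA -colE !mxE.
have eq_cols (A B : 'M[R]_m) : (forall j, col j A = col j B) -> A = B.
  by move=> AB; apply/matrixP => i j; have /colP/(_ i) := AB j; rewrite !mxE.
have QpQ : Qp^T *m Q = 0 by rewrite -[LHS]trmxK trmx_mul trmxK QQp trmx0.
split=> //; apply: eq_cols => j.
set x := col j (1%:M - _); have [/(_ _)] := spanQp x.
have Qx : Q^T *m x = 0.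
  by rewrite /x colE mulmxA mulmxBr mulmx1 mulmxA QQ mul1mx subrr mul0mx.
move=> /(_ Qx)[c xE] _; have cE : c = Qp^T *m x by rewrite xE mulmxA QpQp mul1mx.
rewrite xE cE /x !colE -mulmxA [Qp^T *m (_ *m _)]mulmxA mulmxBr mulmx1 (mulmxA _ Q).
by rewrite QpQ mul0mx subr0.
Qed.

Lemma pinv_mulVmx m p (W : 'M[R]_(m, p)) : \rank W = p -> pinv W *m W = 1%:M.
Proof.
move=> rkW; have [WBW _ _ _] := pinvP W.
have fW : row_free W^T by rewrite /row_free mxrank_tr rkW.
apply: trmx_inj; apply: (row_free_inj fW).
by rewrite -!trmx_mul mulmxA WBW mulmx1.
Qed.

(** With B = (Y^T Q)^+ and Z = Qp^T N, the left-hand side is the squared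
    norm of Qp Z - Q (B Y^T Qp Z): the two terms are orthogonal, of norms |Z| and
    |B Y^T Qp Z|, and N - Q Q^T N = Qp Z has norm |Z| too. *)
Lemma oblique_proj_error m p q r s (Q : 'M[R]_(m, r)) (Qp : 'M[R]_(m, q))
    (Y : 'M[R]_(m, s)) (N : 'M[R]_(m, p)) :
  orthonormal_cols Q -> is_orth_compl Q Qp -> \rank (Y^T *m Q) = r ->
  frob2 (N - Q *m pinv (Y^T *m Q) *m Y^T *m N) <=
  (1 + spnorm (pinv (Y^T *m Q)) ^+ 2 * spnorm (Y^T *m Qp) ^+ 2) *
    frob2 (N - Q *m Q^T *m N).
Proof.
move=> QQ Qcompl rkYQ; have [QQp QpQ QpQp] := orth_complP QQ Qcompl.
have [QpO _] := Qcompl.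
set B := pinv _; have BYQ : B *m (Y^T *m Q) = 1%:M by apply: pinv_mulVmx.
set Z := Qp^T *m N.
have resE : N - Q *m Q^T *m N = Qp *m Z.
  by rewrite /Z mulmxA QpQp mulmxBl mul1mx.
have NE : N = Q *m (Q^T *m N) + Qp *m Z by rewrite -resE mulmxA subrKC.
have -> : N - Q *m B *m Y^T *m N = Qp *m Z - Q *m (B *m (Y^T *m Qp) *m Z).
  rewrite [in LHS]NE mulmxDr !mulmxA.
  rewrite -(mulmxA _ Y^T Q) -(mulmxA Q B) BYQ mulmx1.
  by rewrite opprD addrACA subrr add0r.
rewrite resE frob2_pythagoras; last first.
  rewrite mulmxN trmx_mul !mulmxA -(mulmxA _ Qp^T Q).
  by rewrite QpQ mulmx0 !mul0mx oppr0.
rewrite frob2N (frob2_orthonormal _ QpO) (frob2_orthonormal _ QQ).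
rewrite mulrDl mul1r lerD2l -mulrA -mulmxA.
apply: le_trans (frob2_spnorm _ _) _; rewrite ler_wpM2l ?sqr_ge0 //.
exact: frob2_spnorm.
Qed.

(** Since M X lies in the column space of Q, the residual of M is also that of
    N = M - M X G V^T, where G = (V^T X)^+ is a true inverse, and it is bounded
    by N itself. Inserting I = V V^T + Vp Vp^T to the right of M, the V part
    cancels, because V^T X G = I, and N becomes Z Vp^T - Z (Vp^T X) G V^T with
    Z = M Vp. These two terms have orthogonal row spaces, and the first is
    M - M V V^T. *)
Lemma rangefinder_error m p q r (M : 'M[R]_(m, p)) (X : 'M[R]_(p, r))
    (Q : 'M[R]_(m, r)) (T : 'M[R]_r) (V : 'M[R]_(p, r)) (Vp : 'M[R]_(p, q)) :
  orthonormal_cols Q -> M *m X = Q *m T ->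
  orthonormal_cols V -> is_orth_compl V Vp -> \rank (V^T *m X) = r ->
  frob2 (M - Q *m Q^T *m M) <=
  (1 + spnorm (Vp^T *m X) ^+ 2 * spnorm (pinv (V^T *m X)) ^+ 2) *
    frob2 (M - M *m V *m V^T).
Proof.
move=> QQ MX VV Vcompl rkVX; have [VVp VpV VpVp] := orth_complP VV Vcompl.
have [VpO _] := Vcompl.
set G := pinv _; have GVX : G *m (V^T *m X) = 1%:M by apply: pinv_mulVmx.
have VXG : V^T *m X *m G = 1%:M := mulmx1C GVX.
set Z := M *m Vp.
have tailE : M - M *m V *m V^T = Z *m Vp^T.
  by rewrite /Z -!mulmxA VpVp mulmxBr mulmx1.
set N := M - M *m X *m G *m V^T.
have NE : N = Z *m Vp^T - Z *m (Vp^T *m X) *m G *m V^T.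
  rewrite /Z !mulmxA -!(mulmxA M) -!mulmxA (mulmxA Vp) VpVp.
  rewrite mulmxBl mul1mx -[V *m V^T *m _]mulmxA (mulmxA V^T).
  rewrite (mulmxA (V^T *m X)) VXG mul1mx.
  by rewrite -mulmxBr opprB addrA subrK /N -!mulmxA mulmxBr mulmx1.
have QN : M - Q *m Q^T *m M = N - Q *m Q^T *m N.
  have QK : Q *m Q^T *m (M *m X *m G *m V^T) = M *m X *m G *m V^T.
    by rewrite MX !mulmxA -(mulmxA Q Q^T) QQ mulmx1.
  by rewrite /N mulmxBr QK opprB addrA subrK.
have le_N : frob2 (N - Q *m Q^T *m N) <= frob2 N.
  rewrite [leRHS](@frob2_proj _ _ _ N (Q *m Q^T)) ?lerDr ?frob2_ge0 //.
    by rewrite trmx_mul trmxK.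
  by rewrite mulmxA -(mulmxA Q) QQ mulmx1.
rewrite QN; apply: le_trans le_N _.
have NtE : N^T = Vp *m Z^T + V *m - (Z *m (Vp^T *m X) *m G)^T.
  by rewrite NE [LHS]linearB /= mulmxN !trmx_mul !trmxK.
rewrite -frob2_tr NtE [leLHS]frob2_pythagoras; last first.
  by rewrite trmx_mul mulmxA -(mulmxA _ _ V) VpV mulmx0 mul0mx.
rewrite (frob2_orthonormal _ VpO) (frob2_orthonormal _ VV) frob2N !frob2_tr.
rewrite tailE -(frob2_tr (Z *m _)) trmx_mul trmxK (frob2_orthonormal _ VpO) frob2_tr.
rewrite mulrDl mul1r lerD2l.
apply: le_trans (frob2_spnormr _ _) _.
rewrite mulrAC ler_wpM2r ?sqr_ge0 // mulrC; exact: frob2_spnormr.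
Qed.

End SketchedProjections.

(** * Leading singular vectors and the Eckart-Young theorem *)

Section SingularVectors.
Variable R : realType.

(** With a rank factorization B = C F, the orthogonal projector onto the row space
    is F^T (F F^T)^-1 F; by cyclicity its trace is that of an identity matrix of
    size the rank of B. *)
Lemma row_space_proj m p (B : 'M[R]_(m, p)) :
  exists H : 'M[R]_p, [/\ H^T = H, H *m H = H, B *m H = B & \tr H = (\rank B)%:R].
Proof.
have := row_base_free B; have := mulmx_base B.
move: (col_base B) (row_base B) => C F BE fF; set G := F *m F^T.
have uG : G \in unitmx.
  by have := @gram_unit R _ _ F^T; rewrite trmxK; apply.
have tG : (invmx G)^T = invmx G by rewrite trmx_inv trmx_mul trmxK.
exists (F^T *m invmx G *m F); split.
- by rewrite !trmx_mul trmxK tG mulmxA.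
- by rewrite !mulmxA -(mulmxA _ F F^T) -/G -(mulmxA _ (invmx G) G) mulVmx ?mulmx1.
- rewrite -{1}BE !mulmxA -(mulmxA _ F F^T) -/G.
  by rewrite -(mulmxA _ G) mulmxV // mulmx1 BE.
- by rewrite mxtrace_mulC mulmxA -/G mulmxV // mxtrace1.
Qed.

(** The linear programming step of Eckart-Young: weights in [0, 1] of total mass at
    most q are best spent on the q largest terms. A threshold t between the terms before
    q and those from q on gives s_i (e_i - c_i) >= t (e_i - c_i) for every i, e
    being the indicator of i < q. *)
Lemma sum_decreasing_weights N (q : nat) (s c : 'I_N -> R) :
  (q <= N)%N -> (forall i, 0 <= s i) ->
  (forall i j : 'I_N, (i <= j)%N -> s j <= s i) ->
  (forall i, 0 <= c i <= 1) -> \sum_i c i <= q%:R ->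
  \sum_i s i * c i <= \sum_(i < N | (i < q)%N) s i.
Proof.
move=> le_qN s_ge0 s_dec c01 sum_c.
pose e (i : 'I_N) : R := (i < q)%N%:R.
have [t [t_ge0 t_le t_ge]] : exists t : R,
    [/\ 0 <= t, forall i : 'I_N, (i < q)%N -> t <= s i
      & forall i : 'I_N, (q <= i)%N -> s i <= t].
  have [lt_qN|le_Nq] := ltnP q N.
    exists (s (Ordinal lt_qN)); split=> // i lt_i; apply: s_dec => //=.
    exact: ltnW.
  exists 0; split=> // i; rewrite leqNgt.
  by rewrite (leq_trans (ltn_ord i) le_Nq).
have sum_e : \sum_i e i = q%:R.
  rewrite /e -natr_sum -(big_mkcond (fun i : 'I_N => (i < q)%N) (fun=> 1%N)) /=.
  by rewrite -(big_ord_widen N (fun=> 1%N) le_qN) sum1_card card_ord.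
have -> : \sum_(i < N | (i < q)%N) s i = \sum_i s i * e i.
  rewrite big_mkcond; apply: eq_bigr => i _; rewrite /e.
  by case: ifP; rewrite ?mulr1 ?mulr0.
rewrite -subr_ge0 -sumrB; apply: (@le_trans _ _ (\sum_i t * (e i - c i))).
  by rewrite -mulr_sumr mulr_ge0 // sumrB sum_e subr_ge0.
apply: ler_sum => i _; rewrite -mulrBr /e; have /andP[ci0 ci1] := c01 i.
case: ltnP => i_q /=.
  by apply: ler_wpM2r; rewrite ?subr_ge0 ?t_le.
by rewrite sub0r !mulrN lerN2 ler_wpM2r // t_ge.
Qed.

Section LeadingVectors.
Variables (m p q : nat) (M : 'M[R]_(m, p)) (V : 'M[R]_(p, q)).
Variables (U : 'M[R]_(m, minn m p)) (s : 'rV[R]_(minn m p)).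
Variables (W : 'M[R]_(p, minn m p)) (le_q : (q <= minn m p)%N).
Hypotheses (svdM : is_svd M U s W) (VE : V = colsub (widen_ord le_q) W).

(* V = W E: the matrix that selects the leading columns. *)
Let E : 'M[R]_(minn m p, q) := colsub (widen_ord le_q) 1%:M.

Let VWE : V = W *m E.
Proof.
rewrite VE; apply/matrixP => i j; rewrite !mxE (bigD1 (widen_ord le_q j)) //=.
rewrite !mxE eqxx mulr1 big1 ?addr0 // => k nk.
by rewrite !mxE (negPf nk) mulr0.
Qed.

Let WW : orthonormal_cols W. Proof. by case: svdM. Qed.
Let UU : orthonormal_cols U. Proof. by case: svdM. Qed.

Lemma leading_orthonormal : orthonormal_cols V.
Proof.
rewrite /orthonormal_cols VWE trmx_mul mulmxA -(mulmxA _ W^T) WW mulmx1.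
apply/matrixP => i j; rewrite !mxE (bigD1 (widen_ord le_q j)) //= !mxE eqxx mulr1.
rewrite big1 ?addr0 => [|k nk]; last by rewrite !mxE (negPf nk) mulr0.
by rewrite eq_sym -!val_eqE.
Qed.

Let frob2_diag k (N : 'M[R]_(minn m p, k)) :
  frob2 (diag_mx s *m N) = \sum_i s 0 i ^+ 2 * \sum_j N i j ^+ 2.
Proof.
rewrite mul_diag_mx frob2E exchange_big /=; apply: eq_bigr => i _.
by rewrite mulr_sumr; apply: eq_bigr => j _; rewrite mxE exprMn.
Qed.

Let frob2_svd k (N : 'M[R]_(p, k)) : frob2 (M *m N) = frob2 (diag_mx s *m (W^T *m N)).
Proof.
by have [_ _ _ _ ->] := svdM; rewrite -!mulmxA (frob2_orthonormal _ UU).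
Qed.

Lemma frob2_leading : frob2 (M *m V) = \sum_(i < minn m p | (i < q)%N) s 0 i ^+ 2.
Proof.
rewrite frob2_svd VWE (mulmxA W^T W) WW mul1mx frob2_diag [RHS]big_mkcond.
apply: eq_bigr => i _; case: ltnP => [lt_iq|le_qi]; last first.
  rewrite big1 ?mulr0 // => j _; rewrite !mxE -val_eqE /= gtn_eqF ?expr0n //.
  exact: leq_trans (ltn_ord j) le_qi.
rewrite (bigD1 (Ordinal lt_iq)) //= big1 => [|j nj].
  by rewrite !mxE -val_eqE /= eqxx addr0 expr1n mulr1.
by rewrite !mxE -val_eqE /= eq_sym (negPf (_ : j != i :> nat)) ?expr0n.
Qed.

Lemma frob2_singular_values : frob2 M = \sum_i s 0 i ^+ 2.
Proof.
have [_ _ _ _ ->] := svdM.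
rewrite -mulmxA (frob2_orthonormal _ UU) -frob2_tr trmx_mul trmxK.
rewrite (frob2_orthonormal _ WW) frob2_tr -[diag_mx s]mulmx1 frob2_diag.
apply: eq_bigr => i _; rewrite (bigD1 i) //= big1 => [|j nj].
  by rewrite mxE eqxx addr0 expr1n mulr1.
by rewrite mxE eq_sym (negPf nj) expr0n.
Qed.

Lemma leading_residual : frob2 M = frob2 (M *m V) + frob2 (M - M *m V *m V^T).
Proof.
have VV := leading_orthonormal.
rewrite (@frob2_projr _ _ _ M (V *m V^T)) ?trmx_mul ?trmxK //; last first.
  by rewrite mulmxA -(mulmxA V) VV mulmx1.
rewrite !mulmxA -[in X in X + _]frob2_tr trmx_mul trmxK.
by rewrite (frob2_orthonormal _ VV) frob2_tr.
Qed.

(** Let H be the projector onto the row space of B. Then M - B restricted to the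
    complement of H is M - M H, so that |M - B|^2 >= |M|^2 - |M H|^2, and it
    remains to see that |M H| <= |M V|. But |M H|^2 is the sum of the s_i^2 c_i
    with c_i = |H w_i|^2, w_i being the right singular vectors; c_i lies in [0, 1]
    and the sum of the c_i is at most \tr H, the rank of B. *)
Lemma eckart_young_svd (B : 'M[R]_(m, p)) :
  (\rank B <= q)%N -> frob2 (M - M *m V *m V^T) <= frob2 (M - B).
Proof.
move=> rkB; have [H [tH HH BH trH]] := row_space_proj B.
have : frob2 (M *m H) <= frob2 (M *m V).
  rewrite frob2_leading frob2_svd frob2_diag; have [_ _ s_ge0 s_dec _] := svdM.
  apply: sum_decreasing_weights => //.
  - by move=> i; apply: sqr_ge0.
  - by move=> i j le_ij; rewrite ler_pXn2r // ?nnegrE //; apply: s_dec.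
  - move=> i; rewrite sumr_ge0 => [/=|j _]; last exact: sqr_ge0.
    (* 1 - c_i is the i-th squared row norm of W^T (1 - H). *)
    have rowE (N : 'M[R]_(p, p)) :
        \sum_j (W^T *m N) i j ^+ 2 = (W^T *m N *m (W^T *m N)^T) i i.
      by rewrite [RHS]mxE; apply: eq_bigr => j _; rewrite expr2 [X in _ = _ * X]mxE.
    have <- : (W^T *m 1%:M *m (W^T *m 1%:M)^T) i i = 1.
      by rewrite mulmx1 trmxK WW mxE eqxx.
    rewrite -rowE -subr_ge0 -sumrB.
    have : 0 <= \sum_j (W^T *m (1%:M - H)) i j ^+ 2.
      by apply: sumr_ge0 => j _; apply: sqr_ge0.
    congr (_ <= _); rewrite rowE sumrB !rowE.
    rewrite !trmx_mul !trmxK [(1%:M - H)^T]linearB /= trmx1 tH.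
    rewrite !mulmxA !mulmx1 -(mulmxA W^T H H) HH.
    rewrite -(mulmxA W^T (_ - _)) mulmxBr mulmx1 mulmxBl mul1mx HH subrr subr0.
    by rewrite mulmxBr mulmx1 mulmxBl !mxE.
  - rewrite exchange_big /= -frob2E; apply: (@le_trans _ _ (frob2 H)); last first.
      by rewrite /frob2 tH HH trH ler_nat.
    rewrite -(frob2_orthonormal (W^T *m H) WW) mulmxA.
    rewrite [leRHS](@frob2_proj _ _ _ H (W *m W^T)) ?lerDl ?frob2_ge0 //.
      by rewrite trmx_mul trmxK.
    by rewrite mulmxA -(mulmxA W) WW mulmx1.
have -> : frob2 (M - B) = frob2 ((M - B) *m H) + frob2 (M - M *m H).
  rewrite (frob2_projr _ tH HH); congr (_ + frob2 _).
  by rewrite mulmxBl BH opprB addrA subrK.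
have := frob2_projr M tH HH; rewrite leading_residual.
have := frob2_ge0 ((M - B) *m H); lra.
Qed.

(** If the q leading singular values are nonzero, V^T M^T Q T = V^T M^T M X =
    D (V^T X) with D the diagonal matrix of their squares, so T divides an
    invertible matrix. If one of them vanishes, so do all those from q on, and
    nothing of M is left outside the span of V. *)
Lemma unit_or_exact_svd (X : 'M[R]_(p, q)) (Q : 'M[R]_(m, q)) (T : 'M[R]_q) :
  M *m X = Q *m T -> \rank (V^T *m X) = q ->
  T \in unitmx \/ M = M *m V *m V^T.
Proof.
move=> MX rkVX; have [_ _ s_ge0 s_dec ME] := svdM.
have [/existsP[i /eqP si0]|/existsPn s_neq0] :=
    boolP [exists i : 'I_q, s 0 (widen_ord le_q i) == 0]; [right|left].
  have : frob2 (M - M *m V *m V^T) = 0.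
    have := leading_residual; rewrite frob2_singular_values frob2_leading.
    rewrite (bigID (fun i : 'I_(minn m p) => (i < q)%N)) /= => /addrI <-.
    rewrite big1 // => j; rewrite -leqNgt => le_qj.
    have sj0 : s 0 j = 0.
      apply/le_anti; rewrite s_ge0 andbT -si0; apply: s_dec => /=.
      exact: leq_trans (ltnW (ltn_ord i)) le_qj.
    by rewrite sj0 expr0n.
  by move=> /frob2_eq0 /eqP; rewrite subr_eq0 => /eqP.
pose D := diag_mx (\row_i s 0 (widen_ord le_q i) ^+ 2).
have SSE : diag_mx s *m (diag_mx s *m E) = E *m D.
  rewrite mul_mx_diag !mul_diag_mx; apply/matrixP => i j; rewrite !mxE.
  by case: eqVneq => [->|_]; rewrite ?mulr1n ?mulr0n ?mulr0 ?mul0r // mulr1 mul1r expr2.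
have MMV : M^T *m (M *m V) = V *m D.
  rewrite VWE -(mulmxA W) -SSE ME !trmx_mul trmxK tr_diag_mx -!mulmxA.
  by rewrite (mulmxA U^T) UU mul1mx (mulmxA W^T W) WW mul1mx.
have : V^T *m M^T *m (M *m X) = D *m (V^T *m X).
  by rewrite -trmx_mul mulmxA -[(M *m V)^T *m M]trmxK trmx_mul trmxK MMV
             trmx_mul tr_diag_mx -mulmxA.
have uD : D *m (V^T *m X) \in unitmx.
  rewrite unitmx_mul -(row_free_unit (V^T *m X)) /row_free rkVX eqxx andbT.
  rewrite unitmxE det_diag unitfE prodf_seq_neq0; apply/allP => i _ /=.
  by rewrite mxE expf_eq0 s_neq0.
by rewrite MX mulmxA => VMQT; move: uD; rewrite -VMQT unitmx_mul => /andP[].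
Qed.

End LeadingVectors.

Lemma leading_rsv_orthonormal m p q (M : 'M[R]_(m, p)) (V : 'M[R]_(p, q)) :
  leading_rsv M V -> orthonormal_cols V.
Proof.
by move=> [U [s [W [le_q [svdM VE]]]]]; apply: leading_orthonormal svdM VE.
Qed.

Lemma eckart_young m p q (M B : 'M[R]_(m, p)) (V : 'M[R]_(p, q)) :
  leading_rsv M V -> (\rank B <= q)%N ->
  frob2 (M - M *m V *m V^T) <= frob2 (M - B).
Proof.
by move=> [U [s [W [le_q [svdM VE]]]]]; apply: eckart_young_svd svdM VE _.
Qed.

Lemma unit_or_exact m p q (M : 'M[R]_(m, p)) (V : 'M[R]_(p, q))
    (X : 'M[R]_(p, q)) (Q : 'M[R]_(m, q)) (T : 'M[R]_q) :
  leading_rsv M V -> M *m X = Q *m T -> \rank (V^T *m X) = q ->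
  T \in unitmx \/ M = M *m V *m V^T.
Proof.
by move=> [U [s [W [le_q [svdM VE]]]]]; apply: (unit_or_exact_svd svdM VE).
Qed.

(** If T is invertible, the two matrices in front of M coincide, because
    (Y^T Q T)^+ = T^-1 (Y^T Q)^+: as Y^T Q has full column rank, the candidate
    satisfies the Penrose equations. Otherwise M = M V V^T, so M is M X times
    some matrix, and both matrices in front of M fix M X. *)
Lemma sketch_proj_eq m p q k (M : 'M[R]_(m, p)) (V : 'M[R]_(p, q))
    (X : 'M[R]_(p, q)) (Y : 'M[R]_(m, k)) (Q : 'M[R]_(m, q)) (T : 'M[R]_q) :
  leading_rsv M V -> M *m X = Q *m T -> \rank (V^T *m X) = q ->
  \rank (Y^T *m Q) = q ->
  M *m X *m pinv (Y^T *m M *m X) *m Y^T *m M =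
  Q *m pinv (Y^T *m Q) *m Y^T *m M.
Proof.
move=> Vlead MX rkVX rkYQ.
set B := pinv (Y^T *m Q).
have BYQ : B *m (Y^T *m Q) = 1%:M by apply: pinv_mulVmx.
have YMX : Y^T *m M *m X = Y^T *m Q *m T by rewrite -mulmxA MX mulmxA.
have [uT|Mexact] := unit_or_exact Vlead MX rkVX.
  have [B1 B2 B3 B4] := pinvP (Y^T *m Q).
  have <- : invmx T *m B = pinv (Y^T *m M *m X).
    apply: penrose_uniq; rewrite YMX.
    have e1 : Y^T *m Q *m T *m (invmx T *m B) = Y^T *m Q *m B.
      by rewrite !mulmxA mulmxK.
    have e2 : invmx T *m B *m (Y^T *m Q *m T) = 1%:M.
      by rewrite mulmxA -(mulmxA (invmx T)) BYQ mulmx1 mulVmx.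
    split; rewrite ?e1 ?e2 ?trmx1 ?mul1mx //.
    by rewrite mulmxA B1.
  by rewrite MX mulmxA mulmxK.
set G := pinv (V^T *m X); have GVX : G *m (V^T *m X) = 1%:M by apply: pinv_mulVmx.
have VXG := mulmx1C GVX.
have ME : M = M *m X *m (G *m V^T).
  rewrite {2}Mexact -(mulmxA (M *m V)) mulmxA -(mulmxA _ _ G) VXG mulmx1.
  exact: Mexact.
have [C1 _ _ _] := pinvP (Y^T *m M *m X).
have fixQ : Q *m B *m Y^T *m (M *m X) = M *m X.
  by rewrite MX mulmxA -(mulmxA _ Y^T) -(mulmxA Q B) BYQ mulmx1.
have fixP : M *m X *m pinv (Y^T *m M *m X) *m Y^T *m (M *m X) = M *m X.
  transitivity (Q *m B *m
      (Y^T *m M *m X *m pinv (Y^T *m M *m X) *m (Y^T *m M *m X))).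
    by rewrite -{1}fixQ !mulmxA.
  by rewrite C1 -[RHS]fixQ !mulmxA.
have fixM (N : 'M[R]_m) : N *m (M *m X) = M *m X -> N *m M = M.
  by move=> NMX; rewrite {1}ME mulmxA NMX -ME.
by rewrite (fixM _ fixP) (fixM _ fixQ).
Qed.

End SingularVectors.

(** * Multilinear products and their matricizations *)

Section MultilinearProducts.
Variables (R : realType) (d : nat) (n : 'I_d -> nat).
Implicit Types (A B : tensor R n) (k : 'I_d) (x y : tidx n).

Lemma big_distr_tidx (m : 'I_d -> nat) (F : forall t, 'I_(m t) -> R) :
  \sum_(z : tidx m) \prod_t F t (z t) = \prod_t \sum_j F t j.
Proof.
rewrite (reindex (@dffun_of_fprod _ (fun t => 'I_(m t)))); last first.
  exact/onW_bij/dffun_of_fprod_bij.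
(* The sums range over different types; distributivity is applied in the
   disjoint union of these types. *)
under [RHS]eq_bigr => t _ do rewrite (big_tag F).
rewrite bigA_distr_big_dep /=.
have := @big_fprod R 0 1 *%R +%R 'I_d (fun t => 'I_(m t)) (fun t => [ffun j => F t j]).
rewrite (eq_bigr (fun z => \prod_t F t (dffun_of_fprod z t))) => [->|z _].
  apply: eq_bigr => g _; apply: eq_bigr => t _.
  by rewrite /untag; case: eqP => // e; rewrite ffunE.
by apply: eq_bigr => t _; rewrite !ffunE.
Qed.

Lemma multi_prod_comp (m p : 'I_d -> nat) (M : forall t, 'M[R]_(p t, m t))
    (N : forall t, 'M[R]_(m t, n t)) A :
  multi_prod M (multi_prod N A) = multi_prod (fun t => M t *m N t) A.
Proof.
apply/ffunP => y; rewrite !multi_prodE.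
under [LHS]eq_bigr => z _ do rewrite multi_prodE mulr_suml.
rewrite exchange_big /=; apply: eq_bigr => x _.
under eq_bigr => z _ do rewrite -mulrA -big_split /=.
rewrite -mulr_sumr; congr (_ * _).
rewrite (big_distr_tidx (fun t j => N t j (x t) * M t (y t) j)).
apply: eq_bigr => t _; rewrite mxE; apply: eq_bigr => j _; exact: mulrC.
Qed.

Lemma eq_multi_prod (m : 'I_d -> nat) (M N : forall t, 'M[R]_(m t, n t)) A :
  (forall t, M t = N t) -> multi_prod M A = multi_prod N A.
Proof.
move=> MN; apply/ffunP => y; rewrite !multi_prodE; apply: eq_bigr => x _.
by congr (_ * _); apply: eq_bigr => t _; rewrite MN.
Qed.

Lemma multi_prodB (m : 'I_d -> nat) (M : forall t, 'M[R]_(m t, n t)) A B :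
  multi_prod M (A - B) = multi_prod M A - multi_prod M B.
Proof.
apply/ffunP => y; rewrite [RHS]ffunE [X in _ = _ + X]ffunE !multi_prodE -sumrB.
by apply: eq_bigr => x _; rewrite !ffunE mulrBl.
Qed.

Lemma multi_prod1 A : multi_prod (fun t => 1%:M : 'M[R]_(n t)) A = A.
Proof.
apply/ffunP => y; rewrite multi_prodE (bigD1 y) //= big1 => [|t _]; last first.
  by rewrite mxE eqxx.
rewrite mulr1 big1 ?addr0 // => x nxy.
have [t nt] : exists t, x t != y t.
  by apply/existsP; apply: contraNT nxy => /existsPn xy; apply/eqP/ffunP => t;
     apply/eqP; have := xy t; rewrite negbK.
by rewrite (bigD1 t) //= mxE eq_sym (negPf nt) mul0r mulr0.
Qed.

(** Mode products by square matrices become multilinear products, so that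
    [multi_prod_comp] gives all their commutation rules. *)
Lemma mode_prodE k (N : 'M[R]_(n k)) A :
  @mode_prod d R n n k N A = multi_prod (dfwith (fun t => 1%:M) N) A.
Proof.
apply/ffunP => y; rewrite ffunE multi_prodE big_mkcond; apply: eq_bigr => x _.
rewrite (bigD1 k) //= dfwith_in; case: ifPn => [/forallP xy|].
  rewrite big1 ?mulr1 // => t ntk; rewrite dfwith_out 1?eq_sym // mxE.
  by have /implyP/(_ ntk) := xy t; rewrite val_eqE => /eqP ->; rewrite eqxx.
rewrite negb_forall => /existsP[t]; rewrite negb_imply => /andP[ntk nxy].
rewrite (bigD1 t) //= dfwith_out 1?eq_sym // mxE.
by rewrite eq_sym -val_eqE (negPf nxy) mul0r !mulr0.
Qed.

Lemma mode_col_off k x y :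
  (forall t, t != k -> x t = y t) -> mode_col k x = mode_col k y.
Proof. by move=> xy; apply: eq_bigr => t /xy ->. Qed.

Lemma matricize_mode_prod k (N : 'M[R]_(n k)) A :
  matricize (@mode_prod d R n n k N A) k = N *m matricize A k.
Proof.
apply/matrixP => i j; rewrite !mxE.
transitivity (\sum_(x : tidx n | mode_col k x == j) A x * N i (x k)).
  under eq_bigr => y /andP[/eqP yk _] do rewrite ffunE yk.
  rewrite (exchange_big_dep (fun x : tidx n => mode_col k x == j)) /=; last first.
    move=> y x /andP[_ /eqP <-] /forallP xy; apply/eqP/mode_col_off => t ntk.
    by have /implyP/(_ ntk) := xy t; rewrite val_eqE => /eqP.
  apply: eq_bigr => x /eqP xj.
  pose y : tidx n := [ffun t => dfwith x i t].
  (* y is the only index that agrees with x off k and has k-th component i. *)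
  rewrite (big_pred1 y) // => z /=.
  apply/andP/eqP => [[/andP[/eqP zi _] /forallP xz]|->].
    apply/ffunP => t; rewrite ffunE; case: dfwithP => // t' nt'.
    by have /implyP := xz t'; rewrite eq_sym => /(_ nt'); rewrite val_eqE => /eqP.
  have yx t : t != k -> y t = x t by move=> ntk; rewrite ffunE dfwith_out // eq_sym.
  split; last by apply/forallP => t; apply/implyP => /yx ->.
  by rewrite ffunE dfwith_in eqxx (mode_col_off yx) xj /=.
rewrite (partition_big (fun x : tidx n => x k) predT) //=.
apply: eq_bigr => s _; rewrite mxE mulr_sumr.
apply: eq_big => [x|x /andP[_ /eqP ->]]; last exact: mulrC.
exact: andbC.
Qed.

Lemma matricizeB A B k : matricize (A - B) k = matricize A k - matricize B k.
Proof.
apply/matrixP => i j; rewrite !mxE -sumrB; apply: eq_bigr => x _.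
by rewrite !ffunE.
Qed.

Lemma matricize_inj k : injective (fun A => matricize A k).
Proof.
by move=> A B AB; apply/ffunP => x; rewrite -(matricizeE A k) -(matricizeE B k) AB.
Qed.

Lemma fnorm_matricize A k : fnorm A = Num.sqrt (frob2 (matricize A k)).
Proof.
(* An entry of the matricization is one entry of A, or 0. *)
congr Num.sqrt; rewrite frob2E exchange_big pair_bigA /=.
rewrite (partition_big (fun x : tidx n => (x k, Ordinal (mode_col_lt k x))) predT) //=.
apply: eq_bigr => -[i j] _ /=; rewrite mxE.
have eqP' (x : tidx n) : ((x k, Ordinal (mode_col_lt k x)) == (i, j)) =
    (x k == i) && (mode_col k x == j) by [].
under eq_bigl do rewrite eqP'.
have [x /andP[/eqP xi /eqP xj]|no] :=
    pickP (fun x : tidx n => (x k == i) && (mode_col k x == j)); last first.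
  by rewrite !big_pred0 // expr0n.
by rewrite !(big_pred1 x) // => y; apply/andP/eqP => [[/eqP yi /eqP yj]|->];
   rewrite ?xi ?xj //; apply: (@mode_col_inj _ _ k); rewrite ?yi ?yj.
Qed.

Lemma fnorm0 : fnorm (0 : tensor R n) = 0.
Proof. by rewrite /fnorm big1 ?sqrtr0 // => x _; rewrite ffunE expr0n. Qed.

Lemma ler_fnormD A B : fnorm (A + B) <= fnorm A + fnorm B.
Proof.
rewrite /fnorm; under eq_bigr do rewrite ffunE.
exact: minkowski_sum.
Qed.

Lemma fnormN A : fnorm (- A) = fnorm A.
Proof. by rewrite /fnorm; under eq_bigr do rewrite ffunE sqrrN. Qed.

(** The product in mode k may be taken first, and it then acts on A itself; so the
    matrices can be exchanged one mode at a time. *)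
Lemma eq_multi_prod_matricize (M N : forall t, 'M[R]_(n t)) A :
  (forall k, M k *m matricize A k = N k *m matricize A k) ->
  multi_prod M A = multi_prod N A.
Proof.
move=> MN; (* H j is N in the modes before j and M in the others. *)
pose H (j : nat) (t : 'I_d) := if (t < j)%N then N t else M t.
have HN : multi_prod (H d) A = multi_prod N A.
  by apply: eq_multi_prod => t; rewrite /H ltn_ord.
rewrite -HN; suff H_const j : (j <= d)%N -> multi_prod M A = multi_prod (H j) A.
  exact: H_const.
elim: j => [|j IHj] lt_jd.
  by apply: eq_multi_prod => t; rewrite /H ltn0.
rewrite {}IHj ?(ltnW lt_jd) //; set k := Ordinal lt_jd.
pose K (t : 'I_d) := if t == k then 1%:M else H j t.
have split_k (F : forall t, 'M[R]_(n t)) (L : 'M[R]_(n k)) :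
    F k = L -> (forall t, t != k -> F t = H j t) ->
    multi_prod F A = multi_prod K (@mode_prod d R n n k L A).
  move=> Fk FH; rewrite mode_prodE multi_prod_comp; apply: eq_multi_prod => t.
  rewrite /K; have [->|ntk] := eqVneq t k; first by rewrite dfwith_in mul1mx.
  by rewrite dfwith_out 1?eq_sym // mulmx1 FH.
have neq_k t : t != k -> (t < j.+1)%N = (t < j)%N.
  by rewrite -val_eqE /= ltnS leq_eqVlt => /negPf ->.
rewrite (split_k (H j) (M k)) //; last by rewrite /H ltnn.
rewrite (split_k (H j.+1) (N k)) => [|//=|t /neq_k e]; last first.
- by rewrite /H e.
- by rewrite /H /= ltnSn.
by congr multi_prod; apply: (@matricize_inj k); rewrite !matricize_mode_prod MN.
Qed.

(** Let T_j be the product over the first j modes, so that |T_j| <= (1 + t)^j.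
    As T_{j+1} A = T_j (A x_j P_j), passing from T_j to T_{j+1} changes the result
    by T_j (A - A x_j P_j), of norm at most (1 + t)^j e t; these add up to a
    geometric sum. *)
Lemma multi_prod_telescope (P : forall t, 'M[R]_(n t)) A (e t : R) :
  0 <= t ->
  (forall k B, fnorm (@mode_prod d R n n k (P k) B) <= (1 + t) * fnorm B) ->
  (forall k, fnorm (A - @mode_prod d R n n k (P k) A) <= e * t) ->
  fnorm (A - multi_prod P A) <= e * ((1 + t) ^+ d - 1).
Proof.
move=> t_ge0 P_le A_le; pose T (j : nat) (s : 'I_d) := if (s < j)%N then P s else 1%:M.
have TP : multi_prod (T d) A = multi_prod P A.
  by apply: eq_multi_prod => s; rewrite /T ltn_ord.
have T0 B : multi_prod (T 0) B = B.
  rewrite -[RHS]multi_prod1; apply: eq_multi_prod => s; by rewrite /T ltn0.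
have T_S j (lt_jd : (j < d)%N) (k := Ordinal lt_jd) B :
    multi_prod (T j.+1) B = multi_prod (T j) (@mode_prod d R n n k (P k) B) /\
    multi_prod (T j.+1) B = @mode_prod d R n n k (P k) (multi_prod (T j) B).
  rewrite !mode_prodE !multi_prod_comp; split; apply: eq_multi_prod => s;
    rewrite /T; (have [->|nsk] := eqVneq s k;
      [by rewrite dfwith_in /= ltnSn ltnn ?mulmx1 ?mul1mx|]);
    rewrite dfwith_out 1?eq_sym // ?mulmx1 ?mul1mx ltnS leq_eqVlt;
    by move: nsk; rewrite -val_eqE /= => /negPf ->.
have T_le j : (j <= d)%N ->
    forall B, fnorm (multi_prod (T j) B) <= (1 + t) ^+ j * fnorm B.
  elim: j => [|j IHj] lt_jd B; first by rewrite T0 expr0 mul1r.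
  rewrite (T_S _ lt_jd _).2; apply: le_trans (P_le _ _) _.
  by rewrite exprS -mulrA ler_wpM2l ?addr_ge0 ?IHj // ltnW.
rewrite -TP; suff T_error j : (j <= d)%N ->
    fnorm (A - multi_prod (T j) A) <= e * ((1 + t) ^+ j - 1) by exact: T_error.
elim: j => [|j IHj] lt_jd.
  by rewrite T0 subrr fnorm0 expr0 subrr mulr0.
have {IHj}IH := IHj (ltnW lt_jd).
rewrite (T_S _ lt_jd _).1; set D := mode_prod _ _.
have -> : A - multi_prod (T j) D = (A - multi_prod (T j) A) + multi_prod (T j) (A - D).
  by rewrite multi_prodB addrA subrK.
apply: le_trans (ler_fnormD _ _) _.
have -> : e * ((1 + t) ^+ j.+1 - 1) = e * ((1 + t) ^+ j - 1) + (1 + t) ^+ j * (e * t).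
  by rewrite exprS; ring.
apply: lerD IH _; apply: le_trans (T_le _ (ltnW lt_jd) _) _.
by rewrite ler_wpM2l ?exprn_ge0 ?addr_ge0 ?A_le.
Qed.

End MultilinearProducts.

(** * The error bound *)

Theorem theorem5p5 (R : realType) (d : nat) (n r l : 'I_d -> nat) (eps : R)
    (A : tensor R n)
    (X : forall k : 'I_d, 'M[R]_(cosize n k, r k))
    (Y : forall k : 'I_d, 'M[R]_(n k, r k + l k))
    (Q : forall k : 'I_d, 'M[R]_(n k, r k))
    (Qperp : forall k : 'I_d, 'M[R]_(n k, n k - r k))
    (V : forall k : 'I_d, 'M[R]_(cosize n k, r k))
    (Vperp : forall k : 'I_d, 'M[R]_(cosize n k, cosize n k - r k))
    (eps_gt0 : 0 < eps)
    (r_le_n : forall k, (r k <= n k)%N)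
    (r_le_cosize : forall k, (r k <= cosize n k)%N)
    (A_Teps : in_Teps eps r A)
    (Q_orth : forall k, is_orth (matricize A k *m X k) (Q k))
    (Qperp_compl : forall k, is_orth_compl (Q k) (Qperp k))
    (V_rsv : forall k, leading_rsv (matricize A k) (V k))
    (Vperp_compl : forall k, is_orth_compl (V k) (Vperp k))
    (YQ_full_rank : forall k, \rank ((Y k)^T *m Q k) = r k)
    (VX_full_rank : forall k, \rank ((V k)^T *m X k) = r k) :
  let Ahat : tensor R n :=
    multi_prod
      (fun k => matricize A k *m X k *m
                  pinv ((Y k)^T *m matricize A k *m X k))
      (multi_prod (fun k => (Y k)^T) A) in
  let tau_ k : R :=
    Num.sqrt (1 + spnorm (pinv ((Y k)^T *m Q k)) ^+ 2 *
                  spnorm ((Y k)^T *m Qperp k) ^+ 2) in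
  let rho_ k : R :=
    Num.sqrt (1 + spnorm ((Vperp k)^T *m X k) ^+ 2 *
                  spnorm (pinv ((V k)^T *m X k)) ^+ 2) in
  let tau : R := \big[Num.max/0]_(k < d) tau_ k in
  let rho : R := \big[Num.max/0]_(k < d) rho_ k in
  fnorm (A - Ahat) <= eps * rho * ((1 + tau) ^+ d - 1).
Proof.
cbv zeta; set Ahat := multi_prod _ (multi_prod _ _).
set tau := \big[Num.max/0]_k Num.sqrt (1 + spnorm (pinv ((Y k)^T *m Q k)) ^+ 2 * _).
set rho := \big[Num.max/0]_k _.
pose tau_ k := Num.sqrt (1 + spnorm (pinv ((Y k)^T *m Q k)) ^+ 2 *
                             spnorm ((Y k)^T *m Qperp k) ^+ 2).
pose rho_ k := Num.sqrt (1 + spnorm ((Vperp k)^T *m X k) ^+ 2 *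
                             spnorm (pinv ((V k)^T *m X k)) ^+ 2).
have VV k := leading_rsv_orthonormal (V_rsv k).
have QQ k : orthonormal_cols (Q k) by have [] := Q_orth k.
have MX k : exists T : 'M_(r k), matricize A k *m X k = Q k *m T.
  by have [_ [T [_ MXk]]] := Q_orth k; exists T.
pose P k := Q k *m pinv ((Y k)^T *m Q k) *m (Y k)^T.
have AhatE : Ahat = multi_prod P A.
  rewrite /Ahat multi_prod_comp; apply: eq_multi_prod_matricize => k.
  have [T MXk] := MX k.
  exact: sketch_proj_eq (V_rsv k) MXk (VX_full_rank k) (YQ_full_rank k).
have tau_ge0 : 0 <= tau by apply: bigmax_ge_id.
have rho_ge0 : 0 <= rho by apply: bigmax_ge_id.
have tau_le k : tau_ k <= tau by apply: le_bigmax.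
have rho_le k : rho_ k <= rho by apply: le_bigmax.
have factor_ge0 (a b : R) : 0 <= 1 + a ^+ 2 * b ^+ 2.
  by rewrite -exprMn addr_ge0 ?sqr_ge0.
have sqrt_mul (a b c : R) : 0 <= a -> 0 <= c -> b <= a * c ->
    Num.sqrt b <= Num.sqrt a * Num.sqrt c.
  by move=> a0 c0 bac; rewrite -sqrtrM // ler_sqrt ?mulr_ge0.
have res_le k (B : tensor R n) : fnorm (B - @mode_prod d R n n k (P k) B) <=
    tau * Num.sqrt (frob2 (matricize B k - Q k *m (Q k)^T *m matricize B k)).
  rewrite (fnorm_matricize _ k) matricizeB matricize_mode_prod.
  apply: le_trans (ler_wpM2r (sqrtr_ge0 _) (tau_le k)).
  apply: sqrt_mul; rewrite ?frob2_ge0 ?factor_ge0 //.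
  exact: (oblique_proj_error _ (QQ k) (Qperp_compl k) (YQ_full_rank k)).
rewrite AhatE; apply: multi_prod_telescope => // k => [B|].
  rewrite mulrDl mul1r -[X in fnorm X](subKr B).
  apply: le_trans (ler_fnormD _ _) _; rewrite fnormN lerD2l.
  apply: le_trans (res_le k B) _; rewrite ler_wpM2l //.
  rewrite (fnorm_matricize B k) ler_sqrt ?frob2_ge0 //.
  rewrite [leRHS](@frob2_proj _ _ _ _ (Q k *m (Q k)^T)) ?lerDr ?frob2_ge0 //.
    by rewrite trmx_mul trmxK.
  by rewrite mulmxA -(mulmxA (Q k)) QQ mulmx1.
apply: le_trans (res_le k A) _; rewrite mulrC ler_wpM2r //.
have [T MXk] := MX k.
apply: (@le_trans _ _ (rho_ k *
    Num.sqrt (frob2 (matricize A k - matricize A k *m V k *m (V k)^T)))).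
  apply: sqrt_mul; rewrite ?frob2_ge0 ?factor_ge0 //.
  exact: (rangefinder_error (QQ k) MXk).
rewrite mulrC; apply: ler_pM; rewrite ?sqrtr_ge0 //.
have [E [E_le rkE]] := A_Teps; apply: le_trans E_le.
rewrite (fnorm_matricize E k) ler_sqrt ?frob2_ge0 //.
apply: le_trans (eckart_young (V_rsv k) (rkE k)) _.
by rewrite -opprB frob2N -matricizeB addrAC subrr add0r.
Qed.
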